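(* Let $0<q,t<1$ and $m\ge 1$. For every $\vec{\mathsf{x}}=(\mathsf{x}_1>\dots>\mathsf{x}_m\ge 0)$ with integer entries, $$\sum_{\vec{\mathsf{y}}}\Upsilon_m(\vec{\mathsf{x}},\vec{\mathsf{y}})=1,$$ where the sum is over all integer vectors $\vec{\mathsf{y}}=(\mathsf{y}_1>\dots>\mathsf{y}_m\ge 0)$ such that $\mathsf{y}_i-\mathsf{x}_i\in\{-1,0\}$ for all $1\le i\le m$.
   Context: For $|p|<1$, $(z;p)_\infty=\prod_{i\ge 0}(1-zp^i)$. For integers $\mathsf{x}_1>\dots>\mathsf{x}_m\ge0$ define $$V_{t,q}(\vec{\mathsf{x}})=\prod_{1\le i<j\le m}\frac{\left(q^{j-i-1}t^{\mathsf{x}_i-\mathsf{x}_j-j+i+1};t\right)_\infty}{\left(q^{j-i}t^{\mathsf{x}_i-\mathsf{x}_j-j+i+1};t\right)_\infty}.$$ For $\vec{\mathsf{x}},\vec{\mathsf{y}}$ strictly decreasing vectors of nonnegative integers of length $m$ with $\mathsf{y}_i-\mathsf{x}_i\in\{-1,0\}$ for all $i$, define $$\Upsilon_m(\vec{\mathsf{x}},\vec{\mathsf{y}})=t^{-\binom m2}\,\frac{V_{t,q}(\vec{\mathsf{y}})}{V_{t,q}(\vec{\mathsf{x}})}\prod_{\substack{1\le i<j\le m\\ \mathsf{y}_i=\mathsf{x}_i,\ \mathsf{y}_j=\mathsf{x}_j-1}}\frac{(1-t^{i-j+\mathsf{x}_i-\mathsf{x}_j+1}q^{j-i-1})(1-t^{i-j+\mathsf{x}_i-\mathsf{x}_j}q^{j-i+1})}{(1-t^{i-j+\mathsf{x}_i-\mathsf{x}_j+1}q^{j-i})(1-t^{i-j+\mathsf{x}_i-\mathsf{x}_j}q^{j-i})}\prod_{i:\,\mathsf{y}_i=\mathsf{x}_i}t^{\mathsf{x}_i}\prod_{i:\,\mathsf{y}_i=\mathsf{x}_i-1}\left(t^{m-i}-q^{m-i}t^{\mathsf{x}_i}\right).$$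 *)

(* Defs.v *)
From mathcomp Require Import all_boot all_order all_algebra.
From mathcomp Require Import all_classical all_reals all_analysis.

Set Implicit Arguments.
Unset Strict Implicit.
Unset Printing Implicit Defensive.

Import Order.TTheory GRing.Theory Num.Theory.
Import numFieldNormedType.Exports.

Local Open Scope classical_set_scope.
Local Open Scope ring_scope.

(* (z; p)_oo, meaningful for |p| < 1, where the partial products converge. *)
Definition qpoch {R : realType} (z p : R) : R :=
  lim ((fun n : nat => \prod_(0 <= i < n) (1 - z * p ^+ i)) @ \oo).

(* Vectors of nonnegative integers are finite functions x : 'I_m -> nat, so
   coordinates are numbered from 0: x ord0 is the first, largest entry.
   Differences j - i do not see this shift, but "m - i" becomes m - i.+1. *)
Definition strictly_decreasing {m : nat} (x : {ffun 'I_m -> nat}) : Prop :=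
  forall i j : 'I_m, (i < j)%N -> (x j < x i)%N.

Definition one_step {m : nat} (x y : {ffun 'I_m -> nat}) : Prop :=
  forall i : 'I_m, (y i)%:Z - (x i)%:Z \in [:: -1; 0].

(* x_i - x_j - j + i, computed in int. *)
Definition gap {m : nat} (x : {ffun 'I_m -> nat}) (i j : 'I_m) : int :=
  (x i)%:Z - (x j)%:Z - j%:Z + i%:Z.

Definition Vtq {R : realType} (t q : R) {m : nat} (x : {ffun 'I_m -> nat}) : R :=
  \prod_(i < m) \prod_(j < m | (i < j)%N)
    (qpoch (q ^+ (j - i - 1) * t ^ (gap x i j + 1)) t /
     qpoch (q ^+ (j - i) * t ^ (gap x i j + 1)) t).

(* The condition y_k = x_k - 1 is written x k = (y k).+1, which excludes the
   truncated case x k = y k = 0. *)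
Definition Upsilon {R : realType} (t q : R) {m : nat}
    (x y : {ffun 'I_m -> nat}) : R :=
  t ^- 'C(m, 2) * (Vtq t q y / Vtq t q x) *
  (\prod_(i < m) \prod_(j < m | [&& (i < j)%N, y i == x i & x j == (y j).+1])
    (((1 - t ^ (gap x i j + 1) * q ^+ (j - i - 1)) *
      (1 - t ^ gap x i j * q ^+ (j - i + 1))) /
     ((1 - t ^ (gap x i j + 1) * q ^+ (j - i)) *
      (1 - t ^ gap x i j * q ^+ (j - i))))) *
  (\prod_(i < m | y i == x i) t ^+ x i) *
  (\prod_(i < m | x i == (y i).+1)
    (t ^+ (m - i.+1) - q ^+ (m - i.+1) * t ^+ x i)).

(* Main.v *)
Require Import Defs.
From mathcomp Require Import all_boot all_order all_algebra.
From mathcomp Require Import all_classical all_reals all_analysis.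
From mathcomp Require Import ring lra zify.

(** Record a transition x -> y by the set S of the coordinates that stay, and put
    w_i = q^(m-1-i) t^(x_i - (m-1-i)), with i counted from 0. In a
    quotient V(y) / V(x) the infinite products telescope, since
    (z; t)_oo = (1 - z) (zt; t)_oo, and only the first factors remain; they are
    rational functions of w_i / w_j = q^(j-i) t^(gap x i j). After
    collecting the powers of q and t, Upsilon becomes, with p = q^-1
    (Upsilon_lower_outside),

      p^C(|S|,2) prod_(s in S) w_s prod_(d notin S) (1 - w_d)
                 prod_(s in S, d notin S) (w_s - p w_d) / (w_s - w_d).

    This weight vanishes on the sets S that do not come from a legal y
    (stay_weight_not_admissible), so the sum over y is the sum over all subsets,
    and the claim reduces to an identity of rational functions
    (sum_subset_weight): the weights of all the subsets of a finite index set
    add up to 1 as soon as the w_i are distinct and nonzero.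

    The identity holds by induction on the number of variables. In one
    variable z = w_a the sum has at most simple poles at the other w_j, and the
    residues there cancel in pairs (root_cleared_sum). It is bounded at
    infinity, as the leading terms of the subsets with and without a cancel
    (size_cleared_sum). Hence it is constant in z, and at z = 0 it is the sum
    for the remaining variables. *)

Set Implicit Arguments.
Unset Strict Implicit.
Unset Printing Implicit Defensive.

Import Order.TTheory GRing.Theory Num.Theory.
Import numFieldNormedType.Exports.

Local Open Scope ring_scope.

(** * A rational identity for sums over subsets *)

Section SubsetSum.
Import boot.fintype boot.finset.

Variables (F : fieldType) (I : finType) (p : F) (w : I -> F).
Implicit Types (A B S D : {set I}).

(** S and D are the two blocks of a partition of the indices; they are separate
    arguments because the induction enlarges each of them on its own. *)
Definition subset_weight S D : F :=
  p ^+ 'C(#|S|, 2) * \prod_(s in S) w s * \prod_(d in D) (1 - w d) *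
  \prod_(s in S) \prod_(d in D) ((w s - p * w d) / (w s - w d)).

(** The scale of 'X in a factor depends only on S, whatever v is; this is what
    makes the top coefficients of two pencils over the same S agree. *)
Definition pencil B S (v : I -> F) : {poly F} :=
  \prod_(j in B) ((if j \in S then p else 1) *: 'X - (v j)%:P).

Lemma sum_subset_setU1 (V : nmodType) (a : I) B (g : {set I} -> V) :
  a \notin B ->
  \sum_(S : {set I} | S \subset a |: B) g S =
  \sum_(S : {set I} | S \subset B) (g S + g (a |: S)).
Proof.
move=> aB; rewrite big_split /= (bigID (fun S : {set I} => a \in S)) /= addrC.
congr (_ + _).
  by apply: eq_bigl => S; rewrite -subsetD1 setU1K.
rewrite (reindex_onto (fun S => a |: S) (fun S => S :\ a)) /=; last first.
  by move=> S /andP[_ aS]; rewrite setD1K.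
apply: eq_bigl => S; rewrite setU11 andbT subUset sub1set setU11 /=.
apply/andP/idP => [[Sa /eqP <-]|SB]; last first.
  have aS : a \notin S by apply: contra aB; apply: (subsetP SB).
  by rewrite setU1K // eqxx; split=> //; apply: subset_trans (subsetUr _ _).
by rewrite subDset subUset sub1set setU11.
Qed.

Lemma prod_subset_split (S B : {set I}) (f g : I -> F) : S \subset B ->
  \prod_(j in B) (if j \in S then f j else g j) =
  \prod_(j in S) f j * \prod_(j in B :\: S) g j.
Proof.
move=> SB; rewrite (big_setID S) /= (setIidPr SB); congr (_ * _).
  by apply: eq_bigr => j ->.
by apply: eq_bigr => j; rewrite inE => /andP[/negbTE ->].
Qed.

Lemma horner_pencil B S v z :
  (pencil B S v).[z] = \prod_(j in B) ((if j \in S then p else 1) * z - v j).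
Proof. by rewrite horner_prod; apply: eq_bigr => j _; rewrite !hornerE. Qed.

(** The products are over each block and over S times D, so a new index
    contributes its own factor and its pairs with the opposite block. *)
Lemma subset_weight_setU1r a S D : a \notin D ->
  subset_weight S (a |: D) =
  subset_weight S D * (1 - w a) * \prod_(s in S) ((w s - p * w a) / (w s - w a)).
Proof.
move=> aD; rewrite /subset_weight (big_setU1 _ aD) /=.
under [X in _ * _ * X = _]eq_bigr do rewrite (big_setU1 _ aD) /=.
by rewrite big_split /=; ring.
Qed.

(** The power p ^+ #|S| is the increment of the binomial exponent; in the
    pencil that comes out of the cleared weight it supplies the factors p in
    p w a - p w s, for s in S. *)
Lemma subset_weight_setU1l a S D : a \notin S ->
  subset_weight (a |: S) D =
  subset_weight S D * p ^+ #|S| * w a * \prod_(d in D) ((w a - p * w d) / (w a - w d)).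
Proof.
move=> aS; rewrite /subset_weight !(big_setU1 _ aS) /= cardsU1 aS add1n.
rewrite binS bin1 exprD.
by ring.
Qed.

(** Multiplication by the common denominator cancels the poles at w a = w j:
    for j in S the quotient (w j - p w a) / (w j - w a) leaves p w a - w j. *)
Lemma subset_weight_pencil_r a B S : a \notin B -> S \subset B ->
    {in B, forall j, w a != w j} ->
  \prod_(j in B) (w a - w j) * subset_weight S (a |: (B :\: S)) =
  subset_weight S (B :\: S) * (1 - w a) * (pencil B S w).[w a].
Proof.
move=> aB SB wa; rewrite subset_weight_setU1r; last by rewrite inE (negbTE aB) andbF.
rewrite [LHS]mulrC -[LHS]mulrA; congr (_ * _); rewrite horner_pencil.
rewrite -[X in X * _]mulr1.
rewrite -[X in _ * X * _](@big1_eq _ _ *%R _ (index_enum I) (mem (B :\: S))).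
rewrite -prod_subset_split // -big_split /=; apply: eq_bigr => j jB.
have wj : w a - w j != 0 by rewrite subr_eq0 wa.
have wj' : w j - w a != 0 by rewrite subr_eq0 eq_sym wa.
by case: ifP => _; field; rewrite ?wj ?wj'.
Qed.

Lemma subset_weight_pencil_l a B S : a \notin B -> S \subset B ->
    {in B, forall j, w a != w j} ->
  \prod_(j in B) (w a - w j) * subset_weight (a |: S) (B :\: S) =
  subset_weight S (B :\: S) * w a * (pencil B S (fun j => p * w j)).[w a].
Proof.
move=> aB SB wa; rewrite subset_weight_setU1l; last first.
  by apply: contra aB; apply: (subsetP SB).
rewrite [LHS](_ : _ = subset_weight S (B :\: S) * w a * (p ^+ #|S| *
  \prod_(d in B :\: S) ((w a - p * w d) / (w a - w d)) *
  \prod_(j in B) (w a - w j))); last by ring.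
congr (_ * _); rewrite horner_pencil -prodr_const.
rewrite -prod_subset_split // -big_split /=.
apply: eq_bigr => j jB.
have wj : w a - w j != 0 by rewrite subr_eq0 wa.
by case: ifP => _; field; rewrite ?wj.
Qed.

Lemma size_pencil B S v : (size (pencil B S v) <= #|B|.+1)%N /\
  (pencil B S v)`_#|B| = \prod_(j in B) (if j \in S then p else 1).
Proof.
rewrite /pencil; move cB : #|B| => n; elim: n B cB => [|n IHn] B.
  by move/eqP; rewrite cards_eq0 => /eqP ->; rewrite !big_set0 size_poly1 coef1.
move=> cB; have /set0Pn[a aB] : B != set0 by rewrite -cards_eq0 cB.
rewrite -(setD1K aB); have aC : a \notin B :\ a by rewrite !inE eqxx.
have [|sC cC] := IHn (B :\ a).
  by move: cB; rewrite (cardsD1 a) aB => -[].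
rewrite !(big_setU1 _ aC) /=; set c := if _ then _ else _.
rewrite mulrBl -scalerAl mulrC -cC; split.
  rewrite (leq_trans (size_polyD _ _)) // geq_max size_polyN mul_polyC.
  rewrite !(leq_trans (size_scale_leq _ _)) //; first by exact: leqW.
  by rewrite (leq_trans (size_polyMleq _ _)) // size_polyX addn2 /= ltnS.
rewrite coefB coefZ coefMX /= coefCM (nth_default _ sC) mulr0 subr0.
exact: erefl.
Qed.

(** The full sum over the subsets of a |: B, times the product of the
    w a - w j over j in B, as a polynomial in the variable 'X = w a: the two
    summands are the subsets that omit a and those that contain it. *)
Definition cleared_sum B : {poly F} := \sum_(S : {set I} | S \subset B)
  subset_weight S (B :\: S) *: ((1 - 'X) * pencil B S w +
                                'X * pencil B S (fun j => p * w j)).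

(** Each of the two summands has degree at most #|B| + 1, and their
    coefficients there are opposite: (1 - X) L + X M = L + X (M - L), where L and M have the same
    coefficient in degree #|B|. *)
Lemma size_cleared_sum B : (size (cleared_sum B) <= #|B|.+1)%N.
Proof.
apply: (big_ind (fun P : {poly F} => (size P <= #|B|.+1)%N)).
- by rewrite size_poly0.
- by move=> P Q sP sQ; rewrite (leq_trans (size_polyD _ _)) // geq_max sP.
move=> S _; rewrite (leq_trans (size_scale_leq _ _)) //.
have [sL cL] := size_pencil B S w.
have [sM cM] := size_pencil B S (fun j => p * w j).
set L := pencil _ _ _ in sL cL *; set M := pencil _ _ _ in sM cM *.
have -> : (1 - 'X) * L + 'X * M = L + (M - L) * 'X by ring.
rewrite (leq_trans (size_polyD _ _)) // geq_max sL /=.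
rewrite (leq_trans (size_polyMleq _ _)) // size_polyX addn2 /= ltnS.
apply/leq_sizeP => i; rewrite leq_eqVlt => /predU1P[<-|Bi].
  by rewrite coefB cL cM subrr.
by rewrite coefB !nth_default ?subrr // (leq_trans _ Bi).
Qed.

Lemma horner_cleared_sum B a : a \notin B -> {in B, forall j, w a != w j} ->
  (cleared_sum B).[w a] = \prod_(j in B) (w a - w j) *
    \sum_(S : {set I} | S \subset a |: B) subset_weight S ((a |: B) :\: S).
Proof.
move=> aB wa; rewrite sum_subset_setU1 // mulr_sumr horner_sum.
apply: eq_bigr => S SB.
have aS : a \notin S by apply: contra aB; apply: (subsetP SB).
have -> : (a |: B) :\: S = a |: (B :\: S).
  by apply/setP=> i; rewrite !inE; case: eqP => // ->; rewrite aS.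
have -> : (a |: B) :\: (a |: S) = B :\: S.
  apply/setP=> i; rewrite !inE; case: eqP => [->|//] /=.
  by rewrite (negbTE aB) andbF.
rewrite mulrDr subset_weight_pencil_r // subset_weight_pencil_l // !hornerE; ring.
Qed.

(** The possible pole at w a = w j is absent: S and j |: S, for S not
    containing j, have opposite residues. Both are expressed through the pencils
    over B :\ j, in terms of the same weight. *)
Lemma root_cleared_sum B j : j \in B -> {in B &, injective w} ->
  (cleared_sum B).[w j] = 0.
Proof.
move=> jB injw; rewrite horner_sum -{1}(setD1K jB).
set C := B :\ j; have jC : j \notin C by rewrite !inE eqxx.
have wj : {in C, forall i, w j != w i}.
  move=> i; rewrite !inE => /andP[ij iB]; apply: contra ij => /eqP e.
  by apply/eqP/injw.
rewrite sum_subset_setU1 //; apply: big1 => S SC.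
have jS : j \notin S by apply: contra jC; apply: (subsetP SC).
have -> : B :\: S = j |: (C :\: S).
  by apply/setP=> i; rewrite !inE; case: eqP => // ->; rewrite jS.
have -> : B :\: (j |: S) = C :\: S.
  by apply/setP=> i; rewrite !inE; case: eqP => [->|//] /=; rewrite ?andbF.
have pr_neq0 : \prod_(i in C) (w j - w i) != 0.
  by apply/prodf_neq0 => i iC; rewrite subr_eq0 wj.
have pencilC v : (pencil C (j |: S) v).[w j] = (pencil C S v).[w j].
  rewrite !horner_pencil; apply: eq_bigr => i iC; rewrite !inE.
  by case: eqP iC jC => // -> ->.
have pencilB T v : (pencil B T v).[w j] =
    ((if j \in T then p else 1) * w j - v j) * (pencil C T v).[w j].
  by rewrite !horner_pencil -(setD1K jB) big_setU1.
(* The j-th factors w j - w j kill one pencil in each of the two terms. *)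
apply: (mulfI pr_neq0); rewrite mulr0 !hornerE !pencilB !pencilC setU11.
rewrite (negbTE jS) mul1r subrr mul0r mulr0 add0r.
rewrite mulrDr ![_ * (subset_weight _ _ * _)]mulrA.
rewrite subset_weight_pencil_r // subset_weight_pencil_l //; ring.
Qed.

(** As a function of one variable w a, the sum is constant: cleared of
    denominators it has degree at most #|B| and agrees with the product of the
    'X - w j at the #|B| + 1 distinct points w j and 0. At 0 every subset that
    contains a drops out, which leaves the sum over the subsets of B. *)
Lemma sum_subset_weight A : {in A &, injective w} -> {in A, forall j, w j != 0} ->
  \sum_(S : {set I} | S \subset A) subset_weight S (A :\: S) = 1.
Proof.
move: {2}#|A| (erefl #|A|) => n; elim: n A => [|n IHn] A.
  move/eqP; rewrite cards_eq0 => /eqP -> _ _.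
  under eq_bigl do rewrite subset0.
  by rewrite big_pred1_eq /subset_weight cards0 setD0 !big_set0 !mulr1.
move=> cA; have /set0Pn[a aA] : A != set0 by rewrite -cards_eq0 cA.
rewrite -(setD1K aA); set B := A :\ a => injw wn0.
have aB : a \notin B by rewrite !inE eqxx.
have wa : {in B, forall j, w a != w j}.
  move=> i iB; apply: contra aB => /eqP e.
  by rewrite (injw _ _ _ _ e) // ?setU11 // inE iB orbT.
have injB : {in B &, injective w}.
  by move=> i j iB jB; apply: injw; rewrite inE ?iB ?jB orbT.
have wB : {in B, forall j, w j != 0} by move=> i iB; apply: wn0; rewrite inE iB orbT.
have IHB : \sum_(S : {set I} | S \subset B) subset_weight S (B :\: S) = 1.
  by apply: IHn => //; move: cA; rewrite (cardsD1 a) aA => -[].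
have clearedE : cleared_sum B = \prod_(j in B) ('X - (w j)%:P).
  apply/eqP; rewrite -subr_eq0; apply/eqP.
  apply: (@roots_geq_poly_eq0 _ _ (0 :: [seq w j | j <- enum B])).
  - rewrite /= rootE hornerD hornerN horner_prod; apply/andP; split.
      rewrite horner_sum subr_eq0; apply/eqP.
      transitivity ((\sum_(S : {set I} | S \subset B) subset_weight S (B :\: S)) *
                    \prod_(j in B) (0 - w j)).
        rewrite mulr_suml; apply: eq_bigr => S SB.
        rewrite hornerZ hornerD !hornerM hornerD hornerN hornerC hornerX subr0.
        rewrite mul1r mul0r addr0 horner_pencil; congr (_ * _).
        by apply: eq_bigr => i _; rewrite mulr0.
      by rewrite IHB mul1r; apply: eq_bigr => i _; rewrite !hornerE.
    apply/allP => _ /mapP[j + ->]; rewrite mem_enum => jB.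
    rewrite rootE hornerD hornerN root_cleared_sum // horner_prod.
    by rewrite (bigD1 j jB) /= !hornerE subrr mul0r oppr0.
  - rewrite /= map_inj_in_uniq ?enum_uniq ?andbT; last first.
      by move=> i j; rewrite !mem_enum; apply: injB.
    apply/mapP => -[j]; rewrite mem_enum => /wB /eqP; exact: nesym.
  - rewrite /= size_map -cardE (leq_trans (size_polyD _ _)) // geq_max.
    rewrite size_cleared_sum size_polyN /= -big_enum /=.
    by rewrite size_prod_XsubC -cardE.
have pr_neq0 : \prod_(j in B) (w a - w j) != 0.
  by apply/prodf_neq0 => i iB; rewrite subr_eq0 wa.
apply: (mulfI pr_neq0); rewrite -horner_cleared_sum // clearedE horner_prod mulr1.
by apply: eq_bigr => i _; rewrite !hornerE.
Qed.
End SubsetSum.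

Local Open Scope classical_set_scope.

(** * The infinite q-Pochhammer product *)

Section Qpoch.
Variables (R : realType) (t : R).
Hypothesis ht : 0 < t < 1.
Implicit Types (z : R) (n : nat).

Lemma qpoch_factor_itv z n : 0 <= z <= 1 -> 0 <= 1 - z * t ^+ n <= 1.
Proof.
move=> /andP[z0 z1]; have /andP[t0 t1] := ht.
have tn0 : 0 <= t ^+ n by rewrite exprn_ge0 ?ltW.
have tn1 : t ^+ n <= 1 by rewrite exprn_ile1 ?ltW.
by rewrite subr_ge0 mulr_ile1 //= gerBl mulr_ge0.
Qed.

Lemma qpoch_partial_itv z n : 0 <= z <= 1 ->
  0 <= \prod_(0 <= i < n) (1 - z * t ^+ i) <= 1.
Proof.
move=> hz; elim: n => [|n /andP[P0 P1]]; first by rewrite big_geq // ler01 lexx.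
have /andP[a0 a1] := qpoch_factor_itv n hz.
by rewrite big_nat_recr //= mulr_ge0 //= mulr_ile1.
Qed.

Lemma is_cvg_qpoch z : 0 <= z <= 1 ->
  cvgn (fun n => \prod_(0 <= i < n) (1 - z * t ^+ i)).
Proof.
move=> hz; apply: nonincreasing_is_cvgn.
  apply/nonincreasing_seqP => n; rewrite big_nat_recr //=.
  have /andP[P0 _] := qpoch_partial_itv n hz.
  by have /andP[_ a1] := qpoch_factor_itv n hz; rewrite ler_piMr.
by exists 0 => _ [n _ <-]; have /andP[] := qpoch_partial_itv n hz.
Qed.

Lemma qpochS z : 0 <= z <= 1 -> qpoch z t = (1 - z) * qpoch (z * t) t.
Proof.
move=> hz; have /andP[t0 t1] := ht; have /andP[z0 z1] := hz.
have hzt : 0 <= z * t <= 1 by rewrite mulr_ge0 ?mulr_ile1 //= ltW.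
apply/cvg_lim => //; rewrite -cvg_shiftS /=.
rewrite (_ : (fun n => _) =
    (fun n => (1 - z) * \prod_(0 <= i < n) (1 - z * t * t ^+ i))); last first.
  apply/funext => n; rewrite big_nat_recl //= expr0 mulr1; congr (_ * _).
  by apply: eq_bigr => i _; rewrite exprS mulrA.
by apply: cvgMr; apply: is_cvg_qpoch.
Qed.

(** The partial products stay above (1 + t^n) / 2: the factor 1 - z t^n lowers
    them by at most z t^n, which is at most (t^n - t^(n+1)) / 2. *)
Lemma qpoch_small_gt0 z : 0 <= z -> 2 * z <= 1 - t -> 0 < qpoch z t.
Proof.
move=> z0 hz2; have /andP[t0 t1] := ht.
have hz : 0 <= z <= 1 by lra.
have bnd n : 1 + t ^+ n <= 2 * \prod_(0 <= i < n) (1 - z * t ^+ i).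
  elim: n => [|n IHn]; first by rewrite big_geq // expr0; lra.
  have /andP[P0 P1] := qpoch_partial_itv n hz.
  rewrite big_nat_recr //= exprS; set P := \prod_(_ <= _ < _) _ in IHn P0 P1 *.
  have tn0 : 0 <= t ^+ n by rewrite exprn_ge0 ?ltW.
  have : z * t ^+ n * P <= z * t ^+ n by rewrite ler_piMr ?mulr_ge0.
  have : 2 * z * t ^+ n <= (1 - t) * t ^+ n by rewrite ler_wpM2r.
  lra.
apply: (@lt_le_trans _ _ (2^-1)); first by rewrite invr_gt0.
apply: limr_ge; first exact: is_cvg_qpoch.
apply: nearW => n; have := bnd n.
have tn0 : 0 <= t ^+ n by rewrite exprn_ge0 ?ltW.
by set P := \prod_(_ <= _ < _) _; lra.
Qed.

(** After enough applications of qpochS the argument is small enough for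
    qpoch_small_gt0. *)
Lemma qpoch_gt0 z : 0 <= z < 1 -> 0 < qpoch z t.
Proof.
move=> /andP[z0 z1]; have /andP[t0 t1] := ht.
have [N hN] : exists N, 2 * (z * t ^+ N) <= 1 - t.
  have : t ^+ n @[n --> \oo] --> (0 : R) by apply: cvg_expr; rewrite ger0_norm ?ltW.
  move=> /cvgrPdist_le /(_ ((1 - t) / 2)) []; first by rewrite divr_gt0 ?subr_gt0.
  move=> N _ /(_ N (leqnn N)); rewrite /= sub0r normrN.
  have tN0 : 0 <= t ^+ N by rewrite exprn_ge0 ?ltW.
  rewrite ger0_norm // => tN; exists N.
  have : z * t ^+ N <= t ^+ N by rewrite ler_piMl // ltW.
  lra.
elim: N z z0 z1 hN => [|N IHN] z z0 z1 hN.
  by apply: qpoch_small_gt0 => //; rewrite expr0 mulr1 in hN.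
rewrite qpochS ?z0 ?ltW // mulr_gt0 ?subr_gt0 //; apply: IHN.
- by rewrite mulr_ge0 // ltW.
- by rewrite mulr_ilt1 // ltW.
- by rewrite -mulrA -exprS.
Qed.

Lemma qpoch_quotient z : 0 <= z < 1 -> qpoch z t / qpoch (z * t) t = 1 - z.
Proof.
move=> /andP[z0 z1]; have /andP[t0 t1] := ht; rewrite qpochS ?z0 ?ltW // mulfK //.
by rewrite gt_eqF // qpoch_gt0 // mulr_ge0 ?mulr_ilt1 // ltW.
Qed.

End Qpoch.

(** * Products over pairs of indices *)

(** Turns a product over ordered pairs, such as S times its complement, into
    one over i < j, where it can be compared with Upsilon pair by pair. *)
Lemma big_pairs_lt (T : Type) (idx : T) (op : Monoid.com_law idx) (m : nat)
    (G : 'I_m -> 'I_m -> T) : (forall i, G i i = idx) ->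
  \big[op/idx]_(i < m) \big[op/idx]_(j < m) G i j =
  \big[op/idx]_(i < m) \big[op/idx]_(j < m | (i < j)%N) op (G i j) (G j i).
Proof.
move=> Gii.
under [RHS]eq_bigr do rewrite big_split /=.
rewrite big_split /= [X in op _ X](exchange_big_dep xpredT) //= -big_split /=.
apply: eq_bigr => i _; rewrite (bigID (fun j : 'I_m => (i < j)%N)) /=.
congr (op _ _).
rewrite (bigD1 i) ?ltnn //= Gii Monoid.mul1m; apply: eq_bigl => j.
by rewrite -leqNgt ltn_neqAle andbC.
Qed.

Lemma prod_pairs_in_const (R : comNzRingType) (m : nat) (S : {set 'I_m}) (a : R) :
  \prod_(i < m) \prod_(j < m | (i < j)%N)
     (if (i \in S) && (j \in S) then a else 1) = a ^+ 'C(#|S|, 2).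
Proof.
pose g (i j : 'I_m) : nat := [&& i \in S, j \in S & i != j].
have -> : 'C(#|S|, 2) = (\sum_(i < m) \sum_(j < m | (i < j)%N) g i j)%N.
  have gS : (\sum_(i < m) \sum_(j < m) g i j = #|S| * #|S|.-1)%N.
    rewrite (bigID (mem S)) /= [X in (_ + X)%N]big1 ?addn0; last first.
      by move=> i iS; apply: big1 => j _; rewrite /g (negbTE iS).
    rewrite -sum_nat_const; apply: eq_bigr => i iS.
    rewrite (cardsD1 i S) iS -sum1_card [RHS]big_mkcond; apply: eq_bigr => j _.
    by rewrite /g iS !inE /= eq_sym andbC; case: (_ && _).
  rewrite bin2 -gS big_pairs_lt; last by move=> i; rewrite /g eqxx !andbF.
  rewrite -[RHS]doubleK -addnn -big_split; congr _./2; apply: eq_bigr => i _.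
  by rewrite -big_split; apply: eq_bigr => j _; rewrite /g (eq_sym j i) andbCA.
rewrite expr_sum; apply: eq_bigr => i _; rewrite expr_sum; apply: eq_bigr => j ij.
rewrite /g (_ : i != j) ?andbT; last by rewrite neq_ltn ij.
by case: (_ && _).
Qed.

Lemma prod_gt_const (R : comNzRingType) (m : nat) (i : 'I_m) (a : R) :
  \prod_(j < m | (i < j)%N) a = a ^+ (m - i.+1).
Proof. by rewrite -prodr_const_nat big_geq_mkord. Qed.

(** * Transition weights as subset weights *)

Section Step.
Variables (R : realType) (q t : R) (m : nat) (x : {ffun 'I_m -> nat}).
Hypotheses (hq : 0 < q < 1) (ht : 0 < t < 1) (hx : strictly_decreasing x).
Implicit Types (i j : 'I_m) (S : {set 'I_m}).

Let q0 : 0 < q. Proof. by case/andP: hq. Qed.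
Let q1 : q < 1. Proof. by case/andP: hq. Qed.
Let t0 : 0 < t. Proof. by case/andP: ht. Qed.
Let t1 : t < 1. Proof. by case/andP: ht. Qed.
Let qn0 : q != 0. Proof. by rewrite gt_eqF. Qed.
Let tn0 : t != 0. Proof. by rewrite gt_eqF. Qed.

(** Makes every gap nonnegative, so that the arguments of the q-Pochhammer
    symbols lie in [0, 1). *)
Lemma strictly_decreasing_gap (y : {ffun 'I_m -> nat}) i j :
  strictly_decreasing y -> (i < j)%N -> (y j + (j - i) <= y i)%N.
Proof.
move=> hy; move dE : (j - i)%N => d; elim: d j dE => [|d IHd] j dE ij; first lia.
have [d0|d0] := posnP d; first by have := hy i j ij; lia.
have jm : (j.-1 < m)%N by have := ltn_ord j; lia.
have := IHd (Ordinal jm); rewrite /= => /(_ ltac:(lia) ltac:(lia)).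
have := hy (Ordinal jm) j; rewrite /= => /(_ ltac:(lia)); lia.
Qed.

Lemma gap_ge0 (y : {ffun 'I_m -> nat}) i j :
  strictly_decreasing y -> (i < j)%N -> 0 <= gap y i j.
Proof. by move=> hy ij; have := strictly_decreasing_gap hy ij; rewrite /gap; lia. Qed.

(** Up to a constant this is t^(x_i + i) q^(-i). The normalization absorbs the
    boundary factors: t^(m-i-1) - q^(m-i-1) t^(x_i) becomes
    t^(m-i-1) (1 - position i). An integer exponent avoids truncated
    subtraction. *)
Definition position i : R :=
  q ^+ (m - i.+1) * t ^ ((x i)%:Z - m%:Z + i.+1%:Z).

Lemma position_neq0 i : position i != 0.
Proof. by rewrite mulf_neq0 ?expf_neq0 ?expfz_neq0. Qed.

Lemma position_ratio i j : (i < j)%N ->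
  position i = q ^+ (j - i) * t ^ gap x i j * position j.
Proof.
move=> ij; rewrite /position mulrACA -exprD -expfzDr //; congr (_ ^+ _ * _ ^ _).
  by have := ltn_ord j; lia.
by rewrite /gap; lia.
Qed.

Lemma monomial_itv (a : nat) (g : int) : 0 <= g -> (0 < a)%N || (0 < g) ->
  0 <= q ^+ a * t ^ g < 1.
Proof.
case: g => // g _ ag; rewrite mulr_ge0 ?exprn_ge0 ?ltW //=.
have [g0|g0] := posnP g.
  by move: ag; rewrite g0 ltxx orbF => a0; rewrite mulr1 exprn_ilt1 ?ltW // -lt0n.
apply: (@le_lt_trans _ _ (t ^+ g)).
  by rewrite ler_piMl ?exprn_ge0 ?exprn_ile1 ?ltW.
by rewrite exprn_ilt1 ?ltW // -lt0n.
Qed.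

Lemma position_inj : injective position.
Proof.
have lt i j : (i < j)%N -> position i != position j.
  move=> ij; apply/eqP => e; have := position_ratio ij; rewrite e.
  rewrite -[X in X = _ -> _]mul1r => /(mulIf (position_neq0 j)) r1.
  have := monomial_itv (a := j - i) (gap_ge0 hx ij).
  by rewrite subn_gt0 ij -r1 ltxx andbF => /(_ isT).
move=> i j e; have [/lt|/lt|/val_inj//] := ltngtP i j; by rewrite e eqxx.
Qed.

Definition Vfactor (y : {ffun 'I_m -> nat}) i j : R :=
  qpoch (q ^+ (j - i - 1) * t ^ (gap y i j + 1)) t /
  qpoch (q ^+ (j - i) * t ^ (gap y i j + 1)) t.

Lemma Vfactor_neq0 (y : {ffun 'I_m -> nat}) i j :
  0 <= gap y i j -> Vfactor y i j != 0.
Proof.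
move=> g0; have neq0 a : qpoch (q ^+ a * t ^ (gap y i j + 1)) t != 0.
  by rewrite gt_eqF // qpoch_gt0 // monomial_itv //; lia.
by rewrite mulf_neq0 ?invr_neq0.
Qed.

(** Both infinite products telescope against their shift by t, and only their
    first factors remain. *)
Lemma Vfactor_succ (y y' : {ffun 'I_m -> nat}) i j :
  0 <= gap y i j -> gap y' i j = gap y i j + 1 ->
  Vfactor y' i j / Vfactor y i j =
  (1 - q ^+ (j - i) * t ^ (gap y i j + 1)) /
  (1 - q ^+ (j - i - 1) * t ^ (gap y i j + 1)).
Proof.
move=> g0 e; rewrite /Vfactor e.
have succ a : 0 <= q ^+ a * t ^ (gap y i j + 1) < 1.
  by apply: monomial_itv; lia.
have tg : t ^ (gap y i j + 1 + 1) = t ^ (gap y i j + 1) * t.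
  by rewrite [LHS]expfzDr // expr1z.
rewrite tg !mulrA -!(qpoch_quotient ht (succ _)) !invf_div; ring.
Qed.

Definition lower_outside S : {ffun 'I_m -> nat} :=
  [ffun i => if i \in S then x i else (x i).-1].

(** Positivity outside S is required so that a coordinate equal to 0 is never
    counted as lowered, which makes lower_outside injective here. *)
Definition admissible : set {set 'I_m} :=
  [set S | strictly_decreasing (lower_outside S) /\
           forall i, i \notin S -> (0 < x i)%N].

Definition stay_weight S : R := subset_weight q^-1 position S (~: S).

Lemma lower_outside_stay S i : admissible S ->
  (lower_outside S i == x i) = (i \in S).
Proof.
move=> [_ /(_ i)]; rewrite ffunE.
by case: (i \in S) => [_|/(_ isT)]; lia.
Qed.

Lemma lower_outside_down S i : admissible S ->
  (x i == (lower_outside S i).+1) = (i \notin S).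
Proof.
move=> [_ /(_ i)]; rewrite ffunE.
by case: (i \in S) => [_|/(_ isT)] /=; lia.
Qed.

Lemma gap_lower_outside S i j : admissible S ->
  gap (lower_outside S) i j = gap x i j - (i \notin S)%:Z + (j \notin S)%:Z.
Proof.
move=> [_ h]; have := h i; have := h j; rewrite /gap !ffunE.
by case: (i \in S); case: (j \in S) => /=; lia.
Qed.

(** The weight enforces the constraints by itself. Lowering a
    coordinate equal to 0 is possible only at the last index, whose position is
    then 1, so that a factor 1 - position vanishes. A collision arises only
    from x i = (x j).+1 with i lowered and j fixed; then j = i + 1,
    position i = q * position j, and the cross factor of (j, i) vanishes. *)
Lemma stay_weight_not_admissible S : ~ admissible S -> stay_weight S = 0.
Proof.
move=> nadm; rewrite /stay_weight /subset_weight.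
have [[i iS xi]|pos] := pselect (exists2 i, i \notin S & x i = 0%N).
  suff wi : position i = 1.
    by rewrite (bigD1 (P := mem (~: S)) i) ?inE //= wi subrr mul0r mulr0 mul0r.
  have im : i.+1 = m.
    apply/eqP; rewrite eqn_leq ltn_ord leqNgt; apply/negP => im.
    by have := hx (i := i) (j := Ordinal im) (leqnn _); rewrite xi.
  by rewrite /position im subnn xi expr0 mul1r sub0r addNr expr0z.
have {}pos i : i \notin S -> (0 < x i)%N.
  by move=> iS; rewrite lt0n; apply/eqP => xi; apply: pos; exists i.
have [i [j [ij yij]]] : exists i j,
    (i < j)%N /\ (lower_outside S i <= lower_outside S j)%N.
  apply: contrapT => h; apply: nadm; split=> // i j ij.
  by rewrite ltnNge; apply/negP => yij; apply: h; exists i, j.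
have xij := strictly_decreasing_gap hx ij.
have [iS [jS ex]] : i \notin S /\ j \in S /\ x i = (x j).+1.
  move: yij (pos i) (pos j); rewrite !ffunE.
  by case: (i \in S); case: (j \in S) => //= h1 h2 h3; split=> //; lia.
have ji : (j - i = 1)%N by lia.
have g0 : gap x i j = 0 by rewrite /gap; lia.
have := position_ratio ij; rewrite ji g0 expr0z mulr1 expr1 => wij.
rewrite [X in _ * X](bigD1 j) //= [X in _ * (X * _)](bigD1 i) ?inE //=.
by rewrite wij mulKf // subrr !mul0r mulr0.
Qed.

Lemma stay_weightE S : stay_weight S =
  \prod_(i < m) (if i \in S then position i else 1 - position i) *
  \prod_(i < m) \prod_(j < m | (i < j)%N)
    (if i \in S then if j \in S then q^-1 else
       (position i - q^-1 * position j) / (position i - position j)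
     else if j \in S then
       (position j - q^-1 * position i) / (position j - position i) else 1).
Proof.
rewrite /stay_weight /subset_weight -prod_pairs_in_const.
pose f i j := (position i - q^-1 * position j) / (position i - position j).
have -> : \prod_(i in S) \prod_(j in ~: S) f i j =
    \prod_(i < m) \prod_(j < m) if (i \in S) && (j \notin S) then f i j else 1.
  rewrite big_mkcond; apply: eq_bigr => i _; case: (i \in S) => /=.
    by rewrite big_mkcond; apply: eq_bigr => j _; rewrite inE.
  by rewrite big1_eq.
rewrite big_pairs_lt; last by move=> i; rewrite andbN.
have -> : \prod_(i < m) (if i \in S then position i else 1 - position i) =
    \prod_(i in S) position i * \prod_(i in ~: S) (1 - position i).
  rewrite (bigID (mem S)) /=; congr (_ * _); first by apply: eq_bigr => i ->.
  by apply: eq_big => [i|i /negbTE ->//]; rewrite inE.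
rewrite -!mulrA [LHS]mulrC -!mulrA; congr (_ * (_ * _)).
rewrite -big_split; apply: eq_bigr => i _.
rewrite -big_split /=; apply: eq_bigr => j _.
by rewrite /f; case: (i \in S); case: (j \in S) => /=; rewrite ?mulr1 ?mul1r.
Qed.

(** The factor of Upsilon at a pair i < j, once the two V-quotients have
    telescoped, is the cross factor of the weight; for i in S the power
    q^-1, distributed over all j > i, comes from writing t^(x_i) in terms of
    position i. It cancels the q left over when j is lowered, and it builds
    q^-1 ^+ 'C(#|S|, 2) when j is fixed. *)
Lemma pair_factor S i j : admissible S -> (i < j)%N ->
  Vfactor (lower_outside S) i j / Vfactor x i j *
  (if (i \in S) && (j \notin S) then
   (((1 - t ^ (gap x i j + 1) * q ^+ (j - i - 1)) *
      (1 - t ^ gap x i j * q ^+ (j - i + 1))) /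
     ((1 - t ^ (gap x i j + 1) * q ^+ (j - i)) *
      (1 - t ^ gap x i j * q ^+ (j - i)))) else 1) * (if i \in S then q^-1 else 1) =
  (if i \in S then if j \in S then q^-1 else
       (position i - q^-1 * position j) / (position i - position j)
     else if j \in S then
       (position j - q^-1 * position i) / (position j - position i) else 1).
Proof.
move=> adm ij; have g0 := gap_ge0 hx ij.
have := gap_lower_outside i j adm; have := gap_ge0 adm.1 ij.
have := Vfactor_neq0 g0; rewrite (position_ratio ij).
have qs : q ^+ (j - i) = q * q ^+ (j - i - 1) by rewrite -exprS; congr (_ ^+ _); lia.
have ts : t ^ (gap x i j + 1) = t * t ^ gap x i j by rewrite expfzDr // expr1z mulrC.
have n1 : 1 - q ^+ (j - i) * t ^ gap x i j != 0.
  by rewrite subr_eq0 gt_eqF //; have /andP[] := @monomial_itv (j - i) _ g0 ltac:(lia).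
have n2 a : 1 - q ^+ a * t ^ (gap x i j + 1) != 0.
  rewrite subr_eq0 gt_eqF //.
  by have /andP[] := @monomial_itv a (gap x i j + 1) ltac:(lia) ltac:(lia).
have n3 := n2 (j - i)%N; have {}n2 := n2 (j - i - 1)%N.
have wj := position_neq0 j.
case: (i \in S); case: (j \in S) => /= V0 y0 e.
- by rewrite mulr1 {1}/Vfactor e subr0 addr0 -/(Vfactor x i j) divff // mul1r.
- rewrite (Vfactor_succ g0); last by rewrite e subr0.
  rewrite addn1 exprS; move: n1 n2 n3; rewrite qs ts.
  move: (q ^+ _) (t ^ _) (position j) wj => E G W W0 n1 n2 n3.
  have n4 : q * E * G * W - W != 0.
    by rewrite -[X in _ - X]mul1r -mulrBl mulf_neq0 // subr_eq0 eq_sym -subr_eq0.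
  field; rewrite ?W0 ?qn0 /= ?n4 ?[G * _]mulrC ?[t * G * _]mulrC ?n1 ?n2 ?n3 //.
- have e' : gap x i j = gap (lower_outside S) i j + 1 by rewrite e; lia.
  rewrite !mulr1 -invf_div (Vfactor_succ y0 e') -e' invf_div.
  have n4 : 1 - q ^+ (j - i - 1) * t ^ gap x i j != 0.
    rewrite subr_eq0 gt_eqF //.
    by have /andP[] := @monomial_itv (j - i - 1) _ g0 ltac:(lia).
  move: n1 n4; rewrite qs.
  move: (q ^+ _) (t ^ _) (position j) wj => E G W W0 n1 n4.
  have n5 : W - q * E * G * W != 0.
    by rewrite -[X in X - _]mul1r -mulrBl mulf_neq0.
  by field; rewrite ?W0 ?qn0 ?n5 ?n1 ?n4.
- by rewrite !mulr1 {1}/Vfactor e addrNK -/(Vfactor x i j) divff.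
Qed.

(** The powers of t on the right multiply to t^'C(m, 2), the normalization of
    Upsilon; the powers of q^-1 are those distributed over pairs in
    pair_factor. *)
Lemma single_factor S i :
  (if i \in S then t ^+ x i else t ^+ (m - i.+1) - q ^+ (m - i.+1) * t ^+ x i) =
  t ^+ (m - i.+1) * ((if i \in S then position i else 1 - position i) *
    (if i \in S then q^-1 else 1) ^+ (m - i.+1)).
Proof.
have tx : t ^+ x i = t ^+ (m - i.+1) * t ^ ((x i)%:Z - m%:Z + i.+1%:Z).
  rewrite -[t ^+ x i]/(t ^ (x i)%:Z) -[t ^+ (m - _)]/(t ^ (m - i.+1)%:Z).
  rewrite -expfzDr //; congr (_ ^ _).
  by have := ltn_ord i; lia.
rewrite {}tx /position; case: (i \in S); rewrite ?expr1n.
  by rewrite exprVn; field; rewrite expf_neq0.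
by ring.
Qed.

Lemma Upsilon_lower_outside S : admissible S ->
  Upsilon t q x (lower_outside S) = stay_weight S.
Proof.
move=> adm; rewrite stay_weightE /Upsilon.
have -> : Vtq t q (lower_outside S) / Vtq t q x =
  \prod_(i < m) \prod_(j < m | (i < j)%N)
    (Vfactor (lower_outside S) i j / Vfactor x i j).
  by rewrite -prodf_div; apply: eq_bigr => i _; rewrite -prodf_div.
under [X in _ * _ * X * _ * _]eq_bigr do rewrite big_mkcondr /=.
under [X in _ * X = _]eq_bigl do rewrite lower_outside_down //.
under [X in _ * X * _ = _]eq_bigl do rewrite lower_outside_stay //.
under [X in _ = _ * X]eq_bigr => i _ do under eq_bigr => j ij do
  rewrite -(pair_factor adm ij).
under [X in _ = _ * X]eq_bigr => i _ do rewrite 2!big_split /= prod_gt_const.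
rewrite [X in _ = _ * X]big_split [X in _ = _ * (X * _)]big_split /=.
set VV := \prod_(i < m) \prod_(j < m | _) (Vfactor _ i j / _).
set CC := (X in _ * VV * X * _ * _ = _); set CC' := (X in _ = _ * (VV * X * _)).
have -> : CC = CC'.
  apply: eq_bigr => i _; apply: eq_bigr => j _.
  by rewrite lower_outside_stay // lower_outside_down.
have tC : t ^+ 'C(m, 2) = \prod_(i < m) t ^+ (m - i.+1).
  have := @prod_pairs_in_const R m [set: 'I_m]%SET t; rewrite cardsT card_ord => <-.
  apply: eq_bigr => i _; rewrite -prod_gt_const; apply: eq_bigr => j _.
  by rewrite !finset.in_setT.
have singles : \prod_(i < m | i \in S) t ^+ x i *
    \prod_(i < m | i \notin S) (t ^+ (m - i.+1) - q ^+ (m - i.+1) * t ^+ x i) =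
    t ^+ 'C(m, 2) * (\prod_(i < m) (if i \in S then position i else 1 - position i) *
      \prod_(i < m) (if i \in S then q^-1 else 1) ^+ (m - i.+1)).
  rewrite tC -!big_split /= [RHS](bigID (mem S)) /=.
  by congr (_ * _); apply: eq_bigr => i iS; rewrite -single_factor ?iS ?(negbTE iS).
rewrite -[LHS]mulrA singles.
have tC0 : t ^+ 'C(m, 2) != 0 by rewrite expf_neq0.
by field.
Qed.

Lemma sum_stay_weight : \sum_(S : {set 'I_m}) stay_weight S = 1.
Proof.
rewrite -(@sum_subset_weight _ _ q^-1 position [set: 'I_m]%SET); first last.
- by move=> i _; exact: position_neq0.
- by move=> i j _ _; exact: position_inj.
by apply: eq_big => [S|S _]; rewrite ?finset.subsetT // /stay_weight finset.setTD.
Qed.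

Lemma lower_outside_bij : set_bij admissible
  [set y : {ffun 'I_m -> nat} | strictly_decreasing y /\ one_step x y] lower_outside.
Proof.
split.
- move=> S [hS posS]; split=> // i; have := posS i; rewrite ffunE !inE.
  by case: (i \in S) => [_|/(_ isT)]; lia.
- move=> S T; rewrite !inE => admS admT e; apply/setP => i.
  by rewrite -(lower_outside_stay i admS) -(lower_outside_stay i admT) e.
- move=> y [hy sy]; pose S := [set i | y i == x i]%SET.
  have eyS : lower_outside S = y.
    apply/ffunP => i; have := sy i; rewrite ffunE !inE.
    have [->//|/eqP yx] := eqVneq (y i) (x i).
    by case/orP => /eqP; move: yx; move: (y i) (x i) => a b; lia.
  exists S => //; split; first by rewrite eyS.
  by move=> i; have := sy i; rewrite !inE; lia.
Qed.

Lemma sum_Upsilon : \sum_(y \in [set y : {ffun 'I_m -> nat} |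
   strictly_decreasing y /\ one_step x y]) Upsilon t q x y = 1.
Proof.
rewrite (reindex_fsbig _ _ _ _ lower_outside_bij) -sum_stay_weight.
under eq_fsbigr => S SP do rewrite (Upsilon_lower_outside (set_mem SP)).
apply: fsbig_fwiden; first by move=> S _ /=; exact: mem_index_enum.
  exact: index_enum_uniq.
by move=> S [_ /= nS]; apply: stay_weight_not_admissible.
Qed.
End Step.

Theorem theorem1p1 (R : realType) (q t : R) (hq : 0 < q < 1) (ht : 0 < t < 1)
    (m : nat) (hm : (1 <= m)%N)
    (x : {ffun 'I_m -> nat}) (hx : strictly_decreasing x) :
  \sum_(y \in [set y : {ffun 'I_m -> nat} | strictly_decreasing y /\ one_step x y])
    Upsilon t q x y = 1.
Proof. exact: sum_Upsilon. Qed.
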